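(* Consider the setting, the assumptions on $f$, and the S-NAG algorithm given in the context, with $\alpha>0$. Assume that: (1) $F(x)\to+\infty$ as $\|x\|\to+\infty$; (2) $\gamma_{n+1}/\gamma_n\to1$, $\sum_n\gamma_n=+\infty$ and $\sum_n\gamma_n^2<\infty$; (3) $\nabla F$ is (globally) Lipschitz continuous; (4) there exists $C>0$ such that for all $x\in\mathbb{R}^d$, $\mathbb{E}_\xi[\|\nabla f(x,\xi)\|^2]\le C(1+F(x))$. Then the sequence $(y_n=(m_n,x_n):n\in\mathbb{N})$ given by S-NAG is bounded with probability one.
   Context: $d\ge1$; $\mathbb{R}_+=[0,\infty)$. Setting: $(\Xi,\mathcal T,\mu)$ is a probability space, $f:\mathbb{R}^d\times\Xi\to\mathbb{R}$ is $\mathcal B(\mathbb{R}^d)\otimes\mathcal T$-measurable, and $\mathbb{E}_\xi\varphi(\xi):=\int\varphi\,d\mu$. $\nabla f(x,s)$ denotes the gradient with respect to $x$. Assumptions on $f$: for every $x$, $f(x,\cdot)$ is $\mu$-integrable; for every $s\in\Xi$, $f(\cdot,s)$ is differentiable, and for every $x$, $\nabla f(x,\cdot)$ is $\mu$-integrable; and there is a measurable $\kappa:\mathbb{R}^d\times\Xi\to\mathbb{R}_+$ such that for every $x\in\mathbb{R}^d$, $\kappa(x,\cdot)$ is $\mu$-integrable and there exists $\varepsilon_x>0$ such that for every $s\in\Xi$ and all $u,v$ in the open ball $B(x,\varepsilon_x)$, $\|\nabla f(u,s)-\nabla f(v,s)\|\le\kappa(x,s)\|u-v\|$. Define $F(x)=\mathbb{E}_\xi[f(x,\xi)]$.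 Then $F$ is differentiable and $\nabla F(x)=\mathbb{E}_\xi[\nabla f(x,\xi)]$. $(\gamma_n)_{n\ge1}$ is a sequence of positive reals, $\tau_n=\sum_{k=1}^n\gamma_k$, and $(\xi_n)_{n\ge1}$ are i.i.d. $\Xi$-valued random variables with law $\mu$ on a probability space $(\Omega,\mathcal F,\mathbb{P})$. S-NAG algorithm: given $\alpha>0$, $m_0=0$ and $x_0\in\mathbb{R}^d$, for $n\ge0$, $$m_{n+1}=\Big(1-\frac{\alpha\gamma_{n+1}}{\tau_n}\Big)m_n+\gamma_{n+1}\nabla f(x_n,\xi_{n+1}),\qquad x_{n+1}=x_n-\gamma_{n+1}m_{n+1},$$ where for $n=0$ the first equation is read as $m_1=\gamma_1\nabla f(x_0,\xi_1)$ (since $m_0=0$). *)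

(* Defs.v *)
From HB Require Import structures.
From mathcomp Require Import all_boot all_order all_algebra finmap.
From mathcomp Require Import all_classical all_reals all_analysis.

Set Implicit Arguments.
Unset Strict Implicit.
Unset Printing Implicit Defensive.

Import Order.TTheory GRing.Theory Num.Theory.
Import numFieldNormedType.Exports.

Local Open Scope classical_set_scope.
Local Open Scope ring_scope.

(* The library norm on row vectors is the sup norm, which induces the same
   topology; all the inequalities between norms use this one instead. *)
Definition enorm (R : realType) (d : nat) (x : 'rV[R]_d) : R :=
  Num.sqrt (\sum_(i < d) x 0 i ^+ 2).

(* 'rV[R]_d equipped with its Borel sigma-algebra. *)
Notation borel_rV R d := (g_sigma_algebraType (@open 'rV[R]_d)).

(* The vector of partial derivatives; as the value of a directional derivative
   is a junk value when the limit does not exist, this is only the gradient at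
   the points where g is differentiable. *)
Definition gradient (R : realType) (d : nat) (g : 'rV[R]_d -> R)
    (x : 'rV[R]_d) : 'rV[R]_d :=
  \row_(i < d) 'D_(delta_mx 0 i) g x.

(* gradient_in f x s is the gradient of f(., s) at x. *)
Definition gradient_in (R : realType) (d : nat) (Xi : Type)
    (f : 'rV[R]_d -> Xi -> R) (x : 'rV[R]_d) (s : Xi) : 'rV[R]_d :=
  gradient (fun z => f z s) x.

Section setting.
Context (R : realType) (d : nat) (dXi : measure_display)
  (Xi : measurableType dXi) (mu : probability Xi R).

Definition objective (f : 'rV[R]_d -> Xi -> R) (x : 'rV[R]_d) : R :=
  fine ('E_mu[f x]).

(* Integrability of a vector-valued function is meant coordinatewise. *)
Definition integrable_rV (g : Xi -> 'rV[R]_d) :=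
  forall i : 'I_d, mu.-integrable [set: Xi] (fun s => (g s 0 i)%:E).

Definition locally_lipschitz_gradient (f : 'rV[R]_d -> Xi -> R) :=
  exists kappa : 'rV[R]_d -> Xi -> R,
    [/\ measurable_fun [set: borel_rV R d * Xi] (fun p => kappa p.1 p.2),
        forall x s, 0 <= kappa x s,
        forall x, mu.-integrable [set: Xi] (EFin \o kappa x)
      & forall x, exists2 e : R, 0 < e &
          forall s u v, enorm (u - x) < e -> enorm (v - x) < e ->
            enorm (gradient_in f u s - gradient_in f v s)
              <= kappa x s * enorm (u - v)].

End setting.

Section independence.
Context (R : realType) (dO dXi : measure_display) (Omega : measurableType dO)
  (Xi : measurableType dXi) (P : probability Omega R).

Definition mutually_independent (I : choiceType) (D : set I)
    (X : I -> {RV P >-> Xi}) :=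
  forall (J : {fset I}) (A : I -> set Xi),
    [set` J] `<=` D ->
    (forall i, i \in J -> measurable (A i)) ->
    P (\bigcap_(i in [set` J]) (X i @^-1` A i))
      = (\prod_(i <- J) P (X i @^-1` A i))%E.

Definition iid_with_law (I : choiceType) (D : set I)
    (X : I -> {RV P >-> Xi}) (mu : probability Xi R) :=
  (forall i, D i -> forall A, measurable A -> distribution P (X i) A = mu A) /\
  mutually_independent D X.

End independence.

Definition tau (R : realType) (gamma : nat -> R) (n : nat) : R :=
  \sum_(1 <= k < n.+1) gamma k.

(* snag f gamma alpha x0 xi n is the pair (m_n, x_n) computed from the samples
   xi 1, ..., xi n. For the first step tau 0 = 0 and division by 0 yields 0;
   whatever this value, it is multiplied by m_0 = 0, so that
   m_1 = gamma 1 *: gradient_in f x0 (xi 1). *)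
Fixpoint snag (R : realType) (d : nat) (Xi : Type)
    (f : 'rV[R]_d -> Xi -> R) (gamma : nat -> R) (alpha : R) (x0 : 'rV[R]_d)
    (xi : nat -> Xi) (n : nat) : 'rV[R]_d * 'rV[R]_d :=
  if n is k.+1 then
    let: (m, x) := snag f gamma alpha x0 xi k in
    let m' := (1 - alpha * gamma k.+1 / tau gamma k) *: m
              + gamma k.+1 *: gradient_in f x (xi k.+1) in
    (m', x - gamma k.+1 *: m')
  else (0, x0).

(* Main.v *)
From HB Require Import structures.
Require Import Defs.
From mathcomp Require Import all_boot all_order all_algebra finmap.
From mathcomp Require Import all_classical all_reals all_analysis.
From mathcomp Require Import measurable_realfun ring lra.

Set Implicit Arguments.
Unset Strict Implicit.
Unset Printing Implicit Defensive.

Import Order.TTheory GRing.Theory Num.Theory.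
Import numFieldNormedType.Exports.

Local Open Scope classical_set_scope.
Local Open Scope ring_scope.

(** With [F] the objective and [G] its gradient, take the energy
    [W (m, x) = 1 + F x + |m|^2 / 2], which is nonnegative by the growth
    condition. Write [m' = a m + g p] and [x' = x - g m'], where [p] is the
    stochastic gradient at [x], of mean [G x]. The descent inequality for [F]
    contributes [- g a <G x, m>] to the conditional expectation of [W (m', x')]
    and the kinetic energy contributes [+ g a <m, G x>]: they cancel, so one
    step multiplies [W] in expectation by at most a factor
    [max 1 (a^2) * (1 + O(g^2))].
    The products of these factors are bounded, since [sum gamma^2] is finite
    and [0 <= a <= 1] eventually ([gamma] is bounded and [tau] diverges).
    Dividing [W] by them gives a nonnegative supermartingale, which is almost
    surely bounded by Ville's maximal inequality; the coercivity of [F] then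
    bounds [x], and [F >= -1] bounds [m]. *)

(** * Measurability of the iterates *)

Lemma nbhs_rat_itv (R : realType) (x : R) (A : set R) : nbhs x A ->
  exists p : rat * rat, ratr p.1 < x < ratr p.2 /\
    forall y, ratr p.1 < y < ratr p.2 -> A y.
Proof.
move=> /nbhs_ballP[e /= e0 eA].
have /rat_in_itvoo[q /itvP qx] : x - e < x by rewrite ltrBlDr ltrDl.
have /rat_in_itvoo[r /itvP rx] : x < x + e by rewrite ltrDl.
exists (q, r); split=> [|y /= /andP[qy yr]]; first by rewrite qx rx.
have eq : x - e < ratr q by rewrite qx.
have re : ratr r < x + e by rewrite rx.
by apply: eA; rewrite /ball/= ltr_norml; apply/andP; split; lra.
Qed.

(** Boxes with rational corners are a base of the topology, and there are only countably many of
    them. This reduces Borel measurability of a vector to that of its coordinates. *)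
Lemma open_rV_bigcup (R : realType) (d : nat) (U : set 'rV[R]_d) : open U ->
  U = \bigcup_(pq in [set pq : 'rV[rat]_d * 'rV[rat]_d |
        [set x : 'rV[R]_d | forall i, ratr (pq.1 0 i) < x 0 i < ratr (pq.2 0 i)] `<=` U])
      [set x : 'rV[R]_d | forall i, ratr (pq.1 0 i) < x 0 i < ratr (pq.2 0 i)].
Proof.
move=> oU; apply/seteqP; split=> [x Ux|x [pq /= sub ?]]; last exact: sub.
have [P nP sP] : nbhs x U by exact: open_nbhs_nbhs.
have /choice[p hp] : forall i : 'I_d, exists p : rat * rat,
    ratr p.1 < x 0 i < ratr p.2 /\
    forall y, ratr p.1 < y < ratr p.2 -> P 0 i y.
  by move=> i; apply: nbhs_rat_itv; exact: nP.
exists (\row_i (p i).1, \row_i (p i).2) => /=; last first.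
  by move=> i; rewrite !mxE; have [] := hp i.
move=> y /= hy; apply: sP => i j; rewrite ord1.
by apply: (hp j).2; have := hy j; rewrite !mxE.
Qed.

Lemma measurable_fun_rV d0 (T : measurableType d0) (R : realType) (d : nat)
    (X : T -> borel_rV R d) :
  (forall i, measurable_fun setT (fun t => (X t : 'rV[R]_d) 0 i)) ->
  measurable_fun setT X.
Proof.
move=> mX; apply: (@measurability _ _ T (borel_rV R d) setT X (@open 'rV[R]_d)) => //.
move=> _ [U oU <-]; rewrite setTI (open_rV_bigcup oU) preimage_bigcup.
rewrite bigcup_mkcond; apply: countable_bigcupT_measurable => // pq.
case: ifPn => // _; rewrite [X in measurable X](_ : _ = \bigcap_(i in [set: 'I_d])
    ((fun t => (X t : 'rV[R]_d) 0 i) @^-1`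
      `]ratr (pq.1 0 i), ratr (pq.2 0 i)[%classic)).
  apply: fin_bigcap_measurable => // i _.
  by rewrite -[X in measurable X]setTI; exact: mX.
apply/seteqP; split=> t /= h i; first by move=> _; rewrite /= in_itv/= h.
by have := h i I; rewrite /= in_itv.
Qed.

Lemma continuous_measurable_rV (R : realType) (d : nat) (g : 'rV[R]_d -> R) :
  continuous g -> measurable_fun [set: borel_rV R d] g.
Proof.
move=> cg; rewrite -[X in measurable_fun _ X]/(_ : borel_rV R d -> _).
apply: (@measurability _ _ _ _ setT _ _
  (RGenOpens.measurableE R)).
move=> _ [_ [a [b ->]] <-]; rewrite setTI; apply: sub_sigma_algebra.
by move/continuousP : cg; apply; exact: interval_open.
Qed.

Lemma measurable_coord (R : realType) (d : nat) (i : 'I_d) :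
  measurable_fun [set: borel_rV R d] (fun x : 'rV[R]_d => x 0 i).
Proof. by apply: continuous_measurable_rV; exact: coord_continuous. Qed.

(** Each coordinate is the pointwise limit of difference quotients along the steps [1 / (n + 1)],
    and each quotient is jointly measurable in the point and the sample. *)
Lemma measurable_gradient_in (R : realType) (d : nat) dXi
    (Xi : measurableType dXi) (f : 'rV[R]_d -> Xi -> R) :
  measurable_fun [set: borel_rV R d * Xi] (fun p => f p.1 p.2) ->
  (forall s x, differentiable (fun z => f z s) x) ->
  forall i, measurable_fun [set: borel_rV R d * Xi]
    (fun p => gradient_in f p.1 p.2 0 i).
Proof.
move=> mf df i.
pose e : 'rV[R]_d := delta_mx 0 i.
pose t n : R := n.+1%:R^-1.
apply: (@measurable_fun_cvg _ (borel_rV R d * Xi)%type _ _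
  (fun n p => (t n)^-1 * (f (t n *: e + p.1) p.2 - f p.1 p.2))).
  move=> n; apply: measurable_funM => //; apply: measurable_funB => //.
  have mg : measurable_fun [set: borel_rV R d * Xi]
      (fun p => ((t n *: e + p.1 : borel_rV R d), p.2)).
    apply: measurable_fun_pair => //; apply: measurable_fun_rV => j.
    rewrite [X in measurable_fun _ X](_ : _ =
      fun p : borel_rV R d * Xi => (t n *: e) 0 j + (p.1 : 'rV_d) 0 j).
      apply: measurable_funD => //.
      exact: (measurableT_comp (@measurable_coord R d j)).
    by apply/funext => p; rewrite mxE.
  exact: (measurableT_comp mf mg).
move=> [x s] _ /=.
rewrite /gradient_in /gradient mxE.
have /cvg_ex[l hl] : derivable (fun z => f z s) x e by apply: diff_derivable.
have -> : 'D_e (fun z => f z s) x = l by apply/cvg_lim.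
have ht : t n @[n --> \oo] --> (0 : R)^'.
  move=> A /= hA.
  have h0 : t n @[n --> \oo] --> (0 : R) by exact: cvg_harmonic.
  have : \forall n \near \oo, t n != 0 -> A (t n) by exact: (h0 _ hA).
  by apply: filterS => n; apply; rewrite invr_eq0 pnatr_eq0.
exact: (cvg_comp _ _ ht hl).
Qed.

Definition snag_step (R : realType) (d : nat) (Xi : Type)
    (f : 'rV[R]_d -> Xi -> R) (a g : R) (y : 'rV[R]_d * 'rV[R]_d) (s : Xi) :=
  let m := a *: y.1 + g *: gradient_in f y.2 s in (m, y.2 - g *: m).

Lemma snagS (R : realType) (d : nat) (Xi : Type) (f : 'rV[R]_d -> Xi -> R)
    (gamma : nat -> R) (alpha : R) (x0 : 'rV[R]_d) (xi : nat -> Xi) (n : nat) :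
  snag f gamma alpha x0 xi n.+1 =
    snag_step f (1 - alpha * gamma n.+1 / tau gamma n) (gamma n.+1)
      (snag f gamma alpha x0 xi n) (xi n.+1).
Proof. by rewrite /= /snag_step; case: snag. Qed.

(** In coordinates, closure under a step is scalar arithmetic; [measurable_fun_rV] gives back Borel
    measurability when a function of the vector is composed. *)
Definition measurable_coords d0 (T : measurableType d0) (R : realType)
    (d : nat) (y : T -> 'rV[R]_d * 'rV[R]_d) :=
  (forall i, measurable_fun setT (fun t => (y t).1 0 i)) /\
  (forall i, measurable_fun setT (fun t => (y t).2 0 i)).

Lemma measurable_snag_step (R : realType) (d : nat) dXi
    (Xi : measurableType dXi) (f : 'rV[R]_d -> Xi -> R) (a g : R)
    dT (T : measurableType dT) (y : T -> 'rV[R]_d * 'rV[R]_d) (X : T -> Xi) :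
  measurable_fun [set: borel_rV R d * Xi] (fun p => f p.1 p.2) ->
  (forall s x, differentiable (fun z => f z s) x) ->
  measurable_coords y -> measurable_fun setT X ->
  measurable_coords (fun t => snag_step f a g (y t) (X t)).
Proof.
move=> mf df [m1 m2] mX.
have mg i : measurable_fun setT (fun t => gradient_in f (y t).2 (X t) 0 i).
  have mp : measurable_fun setT (fun t => ((y t).2 : borel_rV R d, X t)).
    by apply: measurable_fun_pair => //; exact: measurable_fun_rV.
  exact: (measurableT_comp (measurable_gradient_in mf df i) mp).
pose m' t i := a * (y t).1 0 i + g * gradient_in f (y t).2 (X t) 0 i.
have mm i : measurable_fun setT (m' ^~ i).
  by apply: measurable_funD; apply: measurable_funM.
have yS t : snag_step f a g (y t) (X t) =
    (\row_i m' t i, (y t).2 - g *: \row_i m' t i).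
  suff <- : a *: (y t).1 + g *: gradient_in f (y t).2 (X t) = \row_i m' t i by [].
  by apply/rowP => i; rewrite /m' !mxE.
split=> i.
  by apply: (eq_measurable_fun (m' ^~ i)) => [t _|]; rewrite ?yS ?mxE.
apply: (eq_measurable_fun (fun t => (y t).2 0 i - g * m' t i)).
  by move=> t _; rewrite yS !mxE.
by apply: measurable_funB => //; exact: measurable_funM.
Qed.

(** Measurability is asked of the samples [1] to [n] alone and [T] is arbitrary, so that the lemma
    applies both to [Omega] and to the sigma-algebra generated by the past. *)
Lemma measurable_snag (R : realType) (d : nat) dXi
    (Xi : measurableType dXi) (f : 'rV[R]_d -> Xi -> R)
    (gamma : nat -> R) (alpha : R) (x0 : 'rV[R]_d)
    dT (T : measurableType dT) (X : nat -> T -> Xi) (n : nat) :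
  measurable_fun [set: borel_rV R d * Xi] (fun p => f p.1 p.2) ->
  (forall s x, differentiable (fun z => f z s) x) ->
  (forall k, (1 <= k <= n)%N -> measurable_fun setT (X k)) ->
  measurable_coords (fun t => snag f gamma alpha x0 (X ^~ t) n).
Proof.
move=> mf df; elim: n => [|n IH] mX.
  by split => i; exact: measurable_cst.
rewrite (_ : (fun t => _) = fun t =>
  snag_step f (1 - alpha * gamma n.+1 / tau gamma n) (gamma n.+1)
    (snag f gamma alpha x0 (X ^~ t) n) (X n.+1 t)); last first.
  by apply/funext => t; exact: snagS.
apply: measurable_snag_step => //; last by apply: mX; rewrite leqnn.
by apply: IH => k /andP[k0 kn]; apply: mX; rewrite k0 (leq_trans kn).
Qed.

(** * Freezing and the maximal inequality *)

(** Independence on the pi-system [C] makes the law of [(w, X w)] the product of [P], restricted to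
    the sigma-algebra of [C], with [mu]; Tonelli then integrates the fresh sample first. This plays
    the part of conditioning on the past. *)
Lemma ge0_integral_freezing dO dXi (Omega : measurableType dO)
    (Xi : measurableType dXi) (R : realType) (P : probability Omega R)
    (mu : probability Xi R) (C : set (set Omega)) (X : Omega -> Xi)
    (h : g_sigma_algebraType C * Xi -> \bar R) :
  measurable_fun setT X -> C `<=` measurable -> setI_closed C -> C setT ->
  (forall A B, C A -> measurable B -> P (A `&` X @^-1` B) = (P A * mu B)%E) ->
  measurable_fun setT h -> (forall p, 0 <= h p)%E ->
  (\int[P]_w h (w, X w) = \int[P]_w \int[mu]_s h (w, s))%E.
Proof.
move=> mX Cm CI CT CX mh h0.
have CsX A B : <<s C >> A -> measurable B ->
    P (A `&` X @^-1` B) = (P A * mu B)%E.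
  move=> sA mB.
  have mXB : measurable (X @^-1` B) by rewrite -[X in measurable X]setTI; exact: mX.
  have muB : (mu B = (fine (mu B))%:E)%E by rewrite fineK ?fin_num_measure.
  have muB0 : 0 <= fine (mu B) by rewrite fine_ge0.
  rewrite muB muleC.
  (* As functions of [A], both sides are finite measures that agree on the pi-system [C], hence on
     the sigma-algebra it generates. *)
  apply: (@g_sigma_algebra_measure_unique _ _ _ C Cm (fun=> setT) (fun=> CT) _
    (mrestr P mXB) (mscale (NngNum muB0) P) CI _ _ A sA) => //.
  - by rewrite bigcup_const//; exists 0%N.
  - move=> D CD; rewrite [RHS](_ : _ = P D * mu B)%E; first exact: CX.
    by rewrite muleC [in RHS]muB.
  - move=> _; apply: (@le_lt_trans _ _ 1%E); last exact: ltry.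
    exact: (probability_le1 P (measurableI _ _ measurableT mXB)).
have Cs : <<s C >> `<=` measurable.
  by apply: smallest_sub => //; exact: sigma_algebra_measurable.
(* The identity of [Omega], seen as a map to the coarser sigma-algebra: its law is the restriction
   of [P]. *)
pose iC (w : Omega) : g_sigma_algebraType C := w.
have miC : measurable_fun setT iC.
  by move=> _ B mB; rewrite setTI; exact: Cs.
have mp : measurable_fun setT (fun w => (iC w, X w)) by exact: measurable_fun_pair.
pose iC' : {mfun Omega >-> g_sigma_algebraType C} :=
  HB.pack iC (isMeasurableFun.Build _ _ _ _ _ miC).
pose p' : {mfun Omega >-> (g_sigma_algebraType C * Xi)%type} :=
  HB.pack (fun w => (iC w, X w)) (isMeasurableFun.Build _ _ _ _ _ mp).
transitivity (\int[distribution P p']_z h z)%E.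
  by rewrite ge0_integral_distribution.
rewrite (eq_measure_integral (distribution P iC' \x mu)%E); last first.
  move=> A mA _; apply/esym/product_measure_unique => // B D mB mD; exact: CsX.
rewrite fubini_tonelli1// ge0_integral_distribution//.
  exact: measurable_fun_fubini_tonelli_F.
by move=> w; apply: integral_ge0.
Qed.

(** The event that the first passage of [V] at or above [lam] does not occur before time [n]; it is
    decided by the values before time [n]. *)
Definition below (T : Type) (R : realType) (V : nat -> T -> R) (lam : R)
    (n : nat) : set T :=
  [set w | forall k, (k < n)%N -> V k w < lam].

Lemma measurable_below dT (T : measurableType dT) (R : realType)
    (V : nat -> T -> R) lam n :
  (forall k, (k < n)%N -> measurable_fun setT (V k)) ->
  measurable (below V lam n).
Proof.
move=> mV; rewrite [X in measurable X](_ : _ = \bigcap_(k in [set k | (k < n)%N])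
  (V k @^-1` `]-oo, lam[%classic)).
  apply: bigcap_measurableType => k kn.
  by rewrite -[X in measurable X]setTI; exact: mV.
by apply/seteqP; split=> w /= h k /h; rewrite /= in_itv.
Qed.

Section maximal_inequality.
Context dO (Omega : measurableType dO) (R : realType) (P : probability Omega R).
Variable V : nat -> Omega -> R.
Hypothesis mV : forall n, measurable_fun setT (V n).
Hypothesis V0 : forall n w, 0 <= V n w.

(** Ville's inequality, by stopping [V] when it first reaches [lam]. The supermartingale property is
    asked on the events [below], where the process has not been stopped yet. *)
Lemma maximal_inequality (lam : R) : 0 < lam ->
  (forall n, \int[P]_(w in below V lam n.+1) (V n.+1 w)%:E
             <= \int[P]_(w in below V lam n.+1) (V n w)%:E)%E ->
  (lam%:E * P [set w | exists n, (lam <= V n w)%R] <= \int[P]_w (V 0 w)%:E)%E.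
Proof.
move=> lam0 sup.
have mb n : measurable (below V lam n) by exact: measurable_below.
have mVD n D : measurable_fun D (fun w => (V n w)%:E).
  by apply: measurable_funTS; apply/measurable_EFinP.
have bS n : below V lam n.+1 `<=` below V lam n.
  by move=> w h k kn; apply: h; rewrite ltnS ltnW.
(* The left-hand side is a lower bound for the expectation of the stopped process at time [n]: paths
   already stopped count for [lam], the others for [V n]. *)
have inv n : (lam%:E * P (~` below V lam n) + \int[P]_(w in below V lam n) (V n w)%:E
    <= \int[P]_w (V 0 w)%:E)%E.
  elim: n => [|n IH].
    rewrite [below _ _ _](_ : _ = setT).
      by rewrite setCT measure0 mule0 add0e.
    by apply/seteqP; split.
  apply: le_trans IH.
  have -> : ~` below V lam n.+1 = ~` below V lam n `|` (below V lam n `\` below V lam n.+1).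
    apply/seteqP; split=> w /=.
      by have [|] := pselect (below V lam n w); [right|left].
    by move=> [h /bS|[]].
  rewrite measureU; [|exact: measurableC|exact: measurableD|]; last first.
    by apply/seteqP; split=> w //= -[? []].
  rewrite ge0_muleDr ?measure_ge0// -addeA leeD2l//.
  have {2}-> : below V lam n = (below V lam n `\` below V lam n.+1) `|` below V lam n.+1.
    by rewrite setUC setDUK.
  rewrite ge0_integral_setU//; last 3 first.
  - exact: measurableD.
  - by move=> w _; rewrite lee_fin.
  - by apply/disj_setPS => w [] [].
  apply: leeD; last exact: sup.
  (* Paths in this difference cross exactly at time [n], so [lam <= V n] there. *)
  rewrite -integral_cst; last exact: measurableD.
  apply: ge0_le_integral => //; first exact: measurableD.
  - by move=> w _; rewrite lee_fin ltW.
  - move=> w [bn]; rewrite lee_fin => /= nb; rewrite leNgt; apply/negP => Vl.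
    by apply: nb => k; rewrite ltnS leq_eqVlt => /orP[/eqP->|/bn].
have -> : [set w | exists n, lam <= V n w] = \bigcup_n ~` below V lam n.
  apply/seteqP; split=> w /=.
    by move=> [n ln]; exists n.+1 => //= h; have := h n (ltnSn n); rewrite ltNge ln.
  move=> [n _ /= nb]; apply: contrapT => h; apply: nb => k kn.
  by rewrite ltNge; apply/negP => lk; apply: h; exists k.
(* The crossing events increase with [n], so the bound passes to their union by continuity of
   [P]. *)
have cP : (lam%:E * P (~` below V lam n))%E @[n --> \oo] -->
    (lam%:E * P (\bigcup_n ~` below V lam n))%E.
  apply: cvgeZl => //; apply: nondecreasing_cvg_mu.
  - by move=> n; exact: measurableC.
  - by apply: bigcup_measurable => n _; exact: measurableC.
  - move=> m n mn; apply/subsetPset/subsetC => w h k km.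
    by apply: h; exact: leq_trans mn.
rewrite -(cvg_lim _ cP)//; apply: lime_le; first exact: (cvgP _ cP).
apply: nearW => n; apply: le_trans (inv n).
by rewrite leeDl// integral_ge0// => w _; rewrite lee_fin.
Qed.

(** Unbounded paths exceed every level [j.+1], an event of probability at most [M / j.+1] by the
    maximal inequality. *)
Lemma ae_bounded_supermartingale (M : R) : (\int[P]_w (V 0 w)%:E <= M%:E)%E ->
  (forall lam n, \int[P]_(w in below V lam n.+1) (V n.+1 w)%:E
             <= \int[P]_(w in below V lam n.+1) (V n w)%:E)%E ->
  {ae P, forall w, exists B : R, forall n, V n w <= B}.
Proof.
move=> V0M sup.
pose U := \bigcap_(j : nat) [set w | exists n, j.+1%:R <= V n w].
have mVj j : measurable [set w | exists n, (j.+1%:R : R) <= V n w].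
  rewrite [X in measurable X](_ : _ = \bigcup_n (V n @^-1` `[j.+1%:R, +oo[%classic)).
    apply: bigcup_measurable => n _.
    by rewrite -[X in measurable X]setTI; exact: mV.
  apply/seteqP; split=> w /=.
    by move=> [n h]; exists n => //=; rewrite in_itv/= h.
  by move=> [n _ /=]; rewrite in_itv/= andbT; exists n.
have M0 : 0 <= M.
  by rewrite -lee_fin; apply: le_trans V0M; apply: integral_ge0 => w _; rewrite lee_fin.
exists U; split.
- exact: bigcap_measurableType.
- apply/eqP; rewrite eq_le measure_ge0 andbT.
  apply/lee_addgt0Pr => e e0; rewrite add0e.
  pose j := Num.truncn (M / e).
  have jM : M / e < j.+1%:R by rewrite truncnS_gt.
  have Uj : (P U <= P [set w | exists n, (j.+1%:R <= V n w)%R])%E.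
    by apply: le_measure; rewrite ?inE//; [exact: bigcap_measurableType|move=> w; exact].
  apply: le_trans Uj _.
  have := @maximal_inequality j.+1%:R (ltr0Sn _ _) (sup _).
  move=> /le_trans/(_ V0M).
  rewrite -[P _]fineK ?fin_num_measure// -EFinM !lee_fin.
  move=> h; rewrite ltr_pdivrMr// in jM.
  have j0 : (0 : R) < j.+1%:R by [].
  rewrite -(ler_pM2l j0); apply: (le_trans h); exact: ltW.
- move=> w /= nb; rewrite /U => j _ /=; apply: contrapT => h; apply: nb.
  exists j.+1%:R => n; rewrite leNgt; apply/negP => Vn; apply: h; exists n.
  exact: ltW.
Qed.

End maximal_inequality.

(** * The gradient of the expected objective *)

Definition dot (R : realType) (d : nat) (u v : 'rV[R]_d) : R :=
  \sum_(i < d) u 0 i * v 0 i.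

Section euclidean.
Context (R : realType) (d : nat).
Implicit Types (u v w : 'rV[R]_d) (c : R).

Lemma dotC u v : dot u v = dot v u.
Proof. by apply: eq_bigr => i _; rewrite mulrC. Qed.

Lemma dotDl u v w : dot (u + v) w = dot u w + dot v w.
Proof. by rewrite /dot -big_split; apply: eq_bigr => i _; rewrite mxE mulrDl. Qed.

Lemma dotZl c u v : dot (c *: u) v = c * dot u v.
Proof. by rewrite /dot mulr_sumr; apply: eq_bigr => i _; rewrite mxE mulrA. Qed.

Lemma dotNl u v : dot (- u) v = - dot u v.
Proof. by rewrite -scaleN1r dotZl mulN1r. Qed.

Lemma dotDr u v w : dot u (v + w) = dot u v + dot u w.
Proof. by rewrite dotC dotDl !(dotC u). Qed.

Lemma dotZr c u v : dot u (c *: v) = c * dot u v.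
Proof. by rewrite dotC dotZl dotC. Qed.

Lemma dotNr u v : dot u (- v) = - dot u v.
Proof. by rewrite dotC dotNl dotC. Qed.

Definition dotE := (dotDl, dotDr, dotNl, dotNr, dotZl, dotZr).

Lemma dot_ge0 u : 0 <= dot u u.
Proof. by apply: sumr_ge0 => i _; rewrite -expr2 sqr_ge0. Qed.

Lemma dot_eq0 u : dot u u = 0 -> u = 0.
Proof.
move=> u0; apply/rowP => i; rewrite mxE; apply/eqP; rewrite -sqrf_eq0 expr2.
move/eqP: u0; rewrite psumr_eq0 => [|j _]; last by rewrite -expr2 sqr_ge0.
by move=> /allP /(_ i); rewrite mem_index_enum; exact.
Qed.

Lemma enorm_sqr u : enorm u ^+ 2 = dot u u.
Proof.
rewrite /enorm sqr_sqrtr; first by apply: eq_bigr => i _; rewrite expr2.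
by apply: sumr_ge0 => i _; rewrite sqr_ge0.
Qed.

Lemma enorm_ge0 u : 0 <= enorm u.
Proof. exact: sqrtr_ge0. Qed.

Lemma enormZ c u : enorm (c *: u) = `|c| * enorm u.
Proof.
apply/eqP; rewrite -(@eqrXn2 _ 2)// ?mulr_ge0 ?enorm_ge0//.
by rewrite exprMn !enorm_sqr real_normK ?num_real// !dotE expr2 mulrA.
Qed.

(** Cauchy-Schwarz: for [v] nonzero, the squared norm of [dot v v *: u - dot u v *: v] is
    nonnegative and equals [dot v v] times the difference of the two sides. *)
Lemma dot_sqr_le u v : dot u v ^+ 2 <= dot u u * dot v v.
Proof.
have [v0|v_neq0] := eqVneq (dot v v) 0.
  by rewrite v0 (dot_eq0 v0) -(scale0r 0) dotZr mul0r mulr0 expr0n.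
have v_gt0 : 0 < dot v v by rewrite lt_neqAle eq_sym v_neq0 dot_ge0.
have := dot_ge0 (dot v v *: u - dot u v *: v).
rewrite !dotE (dotC v u) => h.
rewrite -subr_ge0 -(pmulr_rge0 _ v_gt0); apply: le_trans h _.
by rewrite le_eqVlt; apply/orP; left; apply/eqP; ring.
Qed.

Lemma normr_dot_le u v : `|dot u v| <= enorm u * enorm v.
Proof.
rewrite -(@ler_pXn2r _ 2)// ?nnegrE ?mulr_ge0 ?enorm_ge0//.
by rewrite exprMn !enorm_sqr real_normK ?num_real ?dot_sqr_le.
Qed.

Lemma coord_le_enorm u i : `|u 0 i| <= enorm u.
Proof.
rewrite -(@ler_pXn2r _ 2)// ?nnegrE ?enorm_ge0// enorm_sqr real_normK ?num_real//.
rewrite /dot (bigD1 i)//= -expr2 lerDl; apply: sumr_ge0 => j _.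
by rewrite -expr2 sqr_ge0.
Qed.

Lemma dot_delta u i : dot u (delta_mx 0 i) = u 0 i.
Proof.
rewrite /dot (bigD1 i)//= mxE !eqxx mulr1 big1 ?addr0// => j ji.
by rewrite mxE eqxx (negbTE ji) mulr0.
Qed.

End euclidean.

Lemma derive_gradient (R : realType) (d : nat) (g : 'rV[R]_d -> R) x v :
  differentiable g x -> 'D_v g x = dot (gradient g x) v.
Proof.
move=> dg; rewrite deriveE// [in LHS](row_sum_delta v) linear_sum.
apply: eq_bigr => i _; rewrite linearZ /= -deriveE// /gradient mxE.
by rewrite mulrC.
Qed.

Lemma is_derive_line (R : realType) (V : normedModType R) (g : V -> R)
    (x v : V) (t l : R) :
  is_derive (x + t *: v) v g l -> is_derive t 1 (fun r => g (x + r *: v)) l.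
Proof.
have E : (fun h : R => h^-1 *: ((g \o shift (x + t *: v)) (h *: v) - g (x + t *: v))) =
   (fun h : R => h^-1 *: (((fun r => g (x + r *: v)) \o shift t) (h *: 1) -
     g (x + t *: v))).
  apply/funext => h /=; congr (_ *: (g _ - _)).
  by rewrite [h *: 1]mulr1 scalerDl addrCA addrA.
move=> [dg vg]; split; first by move: dg; rewrite /derivable E.
by move: vg; rewrite /derive E.
Qed.

(** The assumption concerns the direction [v] alone, which is the form in which the derivatives of
    the objective are obtained. *)
Lemma MVT_line (R : realType) (d : nat) (g : 'rV[R]_d -> R)
    (G : 'rV[R]_d -> 'rV[R]_d) x v :
  (forall t, is_derive (x + t *: v) v g (dot (G (x + t *: v)) v)) ->
  exists2 c, 0 <= c <= 1 & g (x + v) - g x = dot (G (x + c *: v)) v.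
Proof.
move=> dg; have dl t := is_derive_line (dg t).
have [] := @MVT R (fun r => g (x + r *: v)) _ 0 1 ltr01 (fun t _ => dl t).
  apply: continuous_subspaceT => t; apply: differentiable_continuous.
  by apply/derivable1_diffP; have [] := dl t.
move=> c; rewrite in_itv/= => /andP[c0 c1].
rewrite scale0r addr0 scale1r subr0 mulr1 => ->.
by exists c => //; rewrite !ltW.
Qed.

Section expected_gradient.
Context (R : realType) (d : nat) (dXi : measure_display)
  (Xi : measurableType dXi) (mu : probability Xi R).
Variable f : 'rV[R]_d -> Xi -> R.
Hypothesis f_int : forall x, mu.-integrable [set: Xi] (EFin \o f x).
Hypothesis f_diff : forall s x, differentiable (fun z => f z s) x.
Hypothesis df_int : forall x, integrable_rV mu (gradient_in f x).
Hypothesis df_lip : locally_lipschitz_gradient mu f.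

Lemma integrable_dot x v :
  mu.-integrable [set: Xi] (fun s => (dot (gradient_in f x s) v)%:E).
Proof.
rewrite (_ : (fun s => _) =
  (fun s => \sum_(i < d) ((v 0 i)%:E * (gradient_in f x s 0 i)%:E))%E).
  by apply: integrable_sum => // i _; apply: integrableZl => //; exact: df_int.
apply/funext => s; rewrite /dot -sumEFin.
by apply: eq_bigr => i _; rewrite EFinM muleC.
Qed.

Definition expected_gradient x : 'rV[R]_d :=
  \row_i (\int[mu]_s gradient_in f x s 0 i)%R.

Lemma Rintegral_dot x v :
  (\int[mu]_s dot (gradient_in f x s) v)%R = dot (expected_gradient x) v.
Proof.
rewrite /Rintegral /dot.
transitivity (fine (\sum_(i < d) \int[mu]_s ((v 0 i)%:E * (gradient_in f x s 0 i)%:E)))%E.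
  congr fine; rewrite -integral_sum//.
    apply: eq_integral => s _; rewrite -sumEFin.
    by apply: eq_bigr => i _; rewrite EFinM muleC.
  by move=> i; apply: integrableZl => //; exact: df_int.
rewrite -sum_fine.
  apply: eq_bigr => i _; rewrite mxE mulrC -RintegralZl//; last exact: df_int.
by move=> i _; apply: integrable_fin_num => //; apply: integrableZl => //; exact: df_int.
Qed.

(** Differentiation under the integral sign in quantitative form: for each sample, the mean value
    theorem and the local Lipschitz bound give a remainder of at most [kappa x s * enorm h ^+ 2].
    Integrating gives [K], the mean of [kappa x]. *)
Lemma objective_expansion x : exists2 e : R, 0 < e & exists2 K : R, 0 <= K &
  forall h, enorm h < e ->
    `|objective mu f (x + h) - objective mu f x - dot (expected_gradient x) h|
      <= K * enorm h ^+ 2.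
Proof.
have [kappa [_ k0 k_int k_lip]] := df_lip.
have [e e0 he] := k_lip x.
exists e => //; exists (\int[mu]_s kappa x s)%R.
  by apply: Rintegral_ge0 => s _; exact: k0.
move=> h hle.
rewrite /objective unlock -Rintegral_dot -![fine _]/(Rintegral _ _ _).
have i1 : mu.-integrable setT (EFin \o (fun s => f (x + h) s - f x s)).
  by rewrite (_ : _ \o _ = (EFin \o f (x + h)) \- (EFin \o f x))%E//; exact: integrableB.
have i2 : mu.-integrable setT (EFin \o (fun s => f (x + h) s - f x s
    - dot (gradient_in f x s) h)).
  rewrite (_ : _ \o _ = (EFin \o (fun s => f (x + h) s - f x s)%R) \-
    (fun s => (dot (gradient_in f x s) h)%:E))%E//.
  by apply: integrableB => //; exact: integrable_dot.
rewrite -RintegralB// -RintegralB//; last exact: integrable_dot.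
rewrite -RintegralZr//.
apply: le_trans (le_normr_Rintegral _ _) _ => //.
apply: le_Rintegral => //.
- exact: integrable_norm.
- rewrite (_ : _ \o _ = fun s => (enorm h ^+ 2)%:E * (EFin \o kappa x) s)%E.
    by apply: integrableZl => //; exact: k_int.
  by apply/funext => s /=; rewrite -EFinM mulrC.
move=> s _.
have [t|c /andP[c0 c1] ->] := @MVT_line _ _ (fun z => f z s) (fun z => gradient_in f z s) x h.
  by rewrite -derive_gradient//; apply/derivableP/diff_derivable.
rewrite -dotNl -dotDl; apply: le_trans (normr_dot_le _ _) _.
rewrite expr2 mulrA ler_wpM2r ?enorm_ge0//.
have hc : enorm (c *: h) <= enorm h.
  by rewrite enormZ ger0_norm// ler_piMl ?enorm_ge0.
apply: le_trans (he s (x + c *: h) x _ _) _.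
- by rewrite addrC addKr; exact: le_lt_trans hc hle.
- by rewrite subrr -(scale0r h) enormZ normr0 mul0r.
by rewrite addrC addKr ler_wpM2l.
Qed.

Lemma is_derive_objective x v :
  is_derive x v (objective mu f) (dot (expected_gradient x) v).
Proof.
have [e e0 [K K0 hK]] := objective_expansion x.
suff H : (fun t : R => t^-1 *: ((objective mu f \o shift x) (t *: v) - objective mu f x))
    @ 0^' --> dot (expected_gradient x) v.
  by split; [exact: (cvgP _ H)|exact: (cvg_lim _ H)].
apply/cvgrPdist_le => /= r r0.
have K1 : 0 < K * enorm v ^+ 2 + 1 by rewrite ltr_wpDl// mulr_ge0 ?sqr_ge0.
have v1 : 0 < enorm v + 1 by rewrite ltr_wpDl ?enorm_ge0.
near=> t.
have t0 : t != 0 by near: t; exact: nbhs_dnbhs_neq.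
(* The first bound brings [t *: v] within the radius [e] of the expansion, the second makes the
   remainder divided by [t] at most [r]. The added 1 keeps the denominators positive. *)
have tsmall : `|t| < Num.min (e / (enorm v + 1)) (r / (K * enorm v ^+ 2 + 1)).
  near: t; apply: dnbhs0_lt; rewrite lt_min !divr_gt0//.
move: tsmall; rewrite lt_min => /andP[te tr].
have htv : enorm (t *: v) < e.
  rewrite enormZ; apply: (@le_lt_trans _ _ (`|t| * (enorm v + 1))).
    by rewrite ler_wpM2l// lerDl.
  by rewrite -ltr_pdivlMr.
have := hK _ htv; rewrite dotZr => h.
rewrite distrC /= -[_ *: _]/(_ * _).
rewrite -(ler_pM2l (_ : 0 < `|t|)) ?normr_gt0// -normrM mulrBr mulVKf// addrC.
rewrite addrC [t *: v + x]addrC.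
apply: le_trans h _.
rewrite enormZ exprMn expr2 mulrCA -mulrA ler_wpM2l//.
rewrite ltr_pdivlMr// in tr.
by apply: le_trans (ltW tr); rewrite ler_wpM2l// lerDl.
Unshelve. all: by end_near.
Qed.

Lemma gradient_objective x : gradient (objective mu f) x = expected_gradient x.
Proof.
apply/rowP => i; rewrite [LHS]mxE.
by have [_ ->] := is_derive_objective x (delta_mx 0 i); rewrite dot_delta.
Qed.

(** The mean value theorem gives the constant [L] where integrating along the segment would give
    [L / 2]; this affects only the constants of [step_factor]. *)
Lemma descent (L : R) x v : 0 <= L ->
  (forall x y : 'rV[R]_d,
     enorm (gradient (objective mu f) x - gradient (objective mu f) y)
       <= L * enorm (x - y)) ->
  objective mu f (x + v) <=
    objective mu f x + dot (expected_gradient x) v + L * dot v v.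
Proof.
move=> L0 lipF.
have [c /andP[c0 c1] /(canRL (subrK _)) ->] := MVT_line (fun t => is_derive_objective (x + t *: v) v).
rewrite addrC -addrA lerD2l.
rewrite -lerBlDl -dotNl -dotDl; apply: le_trans (ler_norm _) _.
apply: le_trans (normr_dot_le _ _) _.
rewrite -enorm_sqr expr2 mulrA ler_wpM2r ?enorm_ge0// -!gradient_objective.
apply: le_trans (lipF _ _) _; rewrite addrAC subrr add0r enormZ ger0_norm//.
by rewrite ler_wpM2l// ler_piMl ?enorm_ge0.
Qed.

End expected_gradient.

(** * One step of the algorithm *)

Section lyapunov.
Context (R : realType) (d : nat) (dXi : measure_display)
  (Xi : measurableType dXi) (mu : probability Xi R).
Variable f : 'rV[R]_d -> Xi -> R.
Hypothesis f_meas :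
  measurable_fun [set: borel_rV R d * Xi] (fun p => f p.1 p.2).
Hypothesis f_int : forall x, mu.-integrable [set: Xi] (EFin \o f x).
Hypothesis f_diff : forall s x, differentiable (fun z => f z s) x.
Hypothesis df_int : forall x, integrable_rV mu (gradient_in f x).
Hypothesis df_lip : locally_lipschitz_gradient mu f.
Variables (C L : R).
Hypothesis C_gt0 : 0 < C.
Hypothesis L_ge0 : 0 <= L.
Hypothesis dF_lip : forall x y : 'rV[R]_d,
  enorm (gradient (objective mu f) x - gradient (objective mu f) y)
    <= L * enorm (x - y).
Hypothesis df_growth : forall x : 'rV[R]_d,
  ('E_mu[fun s => (enorm (gradient_in f x s) ^+ 2)%R]
    <= (C * (1 + objective mu f x))%R%:E)%E.

Let F := objective mu f.
Let G := expected_gradient mu f.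

Definition lyapunov (y : 'rV[R]_d * 'rV[R]_d) : R :=
  1 + objective mu f y.2 + dot y.1 y.1 / 2.

(** The growth condition bounds the expectation of a square by [C * (1 + F x)], with [C]
    positive. *)
Lemma objective_ge_N1 x : 0 <= 1 + F x.
Proof.
rewrite -(pmulr_rge0 _ C_gt0) -lee_fin; apply: le_trans (df_growth x).
by rewrite unlock; apply: integral_ge0 => s _; rewrite lee_fin sqr_ge0.
Qed.

Lemma lyapunov_ge0 y : 0 <= lyapunov y.
Proof. by rewrite addr_ge0 ?divr_ge0 ?dot_ge0//; exact: objective_ge_N1. Qed.

Lemma measurable_objective : measurable_fun [set: borel_rV R d] F.
Proof.
rewrite /F /objective unlock; apply: measurableT_comp => //.
have mf : measurable_fun [set: borel_rV R d * Xi] (fun p => (f p.1 p.2)%:E).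
  exact/measurable_EFinP.
under eq_fun do rewrite integralE.
apply: emeasurable_funB.
  have H : measurable_fun setT (fubini_F mu _) :=
    measurable_fun_fubini_tonelli_F _ (measurable_funepos mf) (funepos_ge0 _).
  by apply: eq_measurable_fun H => x _; apply: eq_integral => s _; rewrite !funeposE.
have H : measurable_fun setT (fubini_F mu _) :=
  measurable_fun_fubini_tonelli_F _ (measurable_funeneg mf) (funeneg_ge0 _).
by apply: eq_measurable_fun H => x _; apply: eq_integral => s _; rewrite !funenegE.
Qed.

Lemma measurable_lyapunov dT (T : measurableType dT)
    (y : T -> 'rV[R]_d * 'rV[R]_d) :
  measurable_coords y -> measurable_fun setT (fun t => lyapunov (y t)).
Proof.
move=> [m1 m2]; apply: measurable_funD.
  apply: measurable_funD => //.
  apply: (measurableT_comp measurable_objective).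
  exact: measurable_fun_rV.
apply: measurable_funM => //; apply: measurable_sum => i.
exact: measurable_funM.
Qed.

Lemma integrable_sqr_gradient x :
  mu.-integrable [set: Xi] (fun s => (enorm (gradient_in f x s) ^+ 2)%:E).
Proof.
apply/integrableP; split.
  apply/measurable_EFinP; under eq_fun do rewrite enorm_sqr.
  apply: measurable_sum => i; have /integrableP[/measurable_EFinP mg _] := df_int x i.
  exact: measurable_funM.
under eq_integral do rewrite gee0_abs ?lee_fin ?sqr_ge0//.
by have := df_growth x; rewrite unlock => /le_lt_trans -> //; exact: ltry.
Qed.

Lemma Rintegral_sqr_gradient x :
  (\int[mu]_s (enorm (gradient_in f x s) ^+ 2))%R <= C * (1 + F x).
Proof.
rewrite -lee_fin fineK; first by have := df_growth x; rewrite unlock.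
exact: integrable_fin_num (integrable_sqr_gradient x).
Qed.

(** The maximum covers the coefficient [a] of the momentum. In the other factor, [4 * L] comes from
    the momentum part of the descent remainder, and the term with [C] from the second moment of the
    stochastic gradient. *)
Definition step_factor (a g : R) : R :=
  Num.max 1 (a ^+ 2) * (1 + (4 * L + C * (1/2 + 2 * L * g ^+ 2)) * g ^+ 2).

(* The terms in [dot m (G x)] coming from [F] and from the kinetic energy
   cancel in expectation. *)
Lemma lyapunov_step (a g : R) y : 0 <= g ->
  (\int[mu]_s (lyapunov (snag_step f a g y s))%:E
    <= (step_factor a g * lyapunov y)%:E)%E.
Proof.
case: y => m x g0.
(* The bound [h] is sorted by its degree in the stochastic gradient [p]: [A] is constant, [B] pairs
   with [p], and [D] multiplies its square. Both [a ^+ 2 * dot m m] and [g ^+ 2 * dot p p] get the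
   coefficient [c]: 1/2 from the kinetic energy and [2 * L * g ^+ 2] from the descent remainder. *)
pose c := 1/2 + 2 * L * g ^+ 2.
have c0 : 0 <= c by rewrite addr_ge0 ?mulr_ge0 ?sqr_ge0//.
pose A := 1 + F x - g * a * dot (G x) m + c * a ^+ 2 * dot m m.
pose B := (a * g) *: m - g ^+ 2 *: G x.
pose D := g ^+ 2 * c.
pose h s := A + (dot (gradient_in f x s) B + D * enorm (gradient_in f x s) ^+ 2).
have le_h s : lyapunov (snag_step f a g (m, x) s) <= h s.
  rewrite /lyapunov /snag_step /=; set p := gradient_in f x s.
  set m' := a *: m + g *: p.
  have := descent f_int f_diff df_int df_lip x (- (g *: m')) L_ge0 dF_lip.
  rewrite -/F -/G => hF.
  (* This bound is applied to the descent remainder only. The kinetic term is expanded exactly,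
     since its cross term has to cancel later. *)
  have Cm : dot m' m' <= 2 * a ^+ 2 * dot m m + 2 * g ^+ 2 * dot p p.
    have := dot_ge0 (a *: m - g *: p); rewrite /m' !dotE (dotC p m) => hm.
    by rewrite -subr_ge0; apply: le_trans hm _; rewrite le_eqVlt; apply/orP; left;
      apply/eqP; ring.
  have hL : L * dot (- (g *: m')) (- (g *: m')) <=
     L * g ^+ 2 * (2 * a ^+ 2 * dot m m + 2 * g ^+ 2 * dot p p).
    have -> : dot (- (g *: m')) (- (g *: m')) = g ^+ 2 * dot m' m'.
      by rewrite dotNl dotNr dotZl dotZr; ring.
    by rewrite -mulrA ler_wpM2l// ler_wpM2l// sqr_ge0.
  apply: (@le_trans _ _ (1 + (F x + dot (G x) (- (g *: m')) +
      L * g ^+ 2 * (2 * a ^+ 2 * dot m m + 2 * g ^+ 2 * dot p p))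
      + dot m' m' / 2)).
    by rewrite lerD2r lerD2l; apply: (le_trans hF); rewrite lerD2l.
  rewrite le_eqVlt; apply/orP; left; apply/eqP.
  rewrite /h /A /B /D /c -/p enorm_sqr /m' !dotE (dotC p m) (dotC p (G x)).
  by field.
have iD : mu.-integrable setT (EFin \o (fun s => D * enorm (gradient_in f x s) ^+ 2)).
  rewrite (_ : _ \o _ = fun s => (D%:E * (enorm (gradient_in f x s) ^+ 2)%:E)%E)//.
  by apply: integrableZl => //; exact: integrable_sqr_gradient.
have iB : mu.-integrable setT (EFin \o (fun s => dot (gradient_in f x s) B)).
  exact: integrable_dot.
have iBD : mu.-integrable setT (EFin \o (fun s => dot (gradient_in f x s) B
    + D * enorm (gradient_in f x s) ^+ 2)).
  rewrite (_ : _ \o _ = (EFin \o (fun s => dot (gradient_in f x s) B)) \+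
    (EFin \o (fun s => D * enorm (gradient_in f x s) ^+ 2)%R))%E//.
  exact: integrableD.
have iA : mu.-integrable setT (EFin \o (fun _ : Xi => A)).
  exact: finite_measure_integrable_cst.
have ih : mu.-integrable setT (EFin \o h).
  rewrite (_ : _ \o _ = (EFin \o (fun _ : Xi => A)) \+
    (EFin \o (fun s => dot (gradient_in f x s) B
       + D * enorm (gradient_in f x s) ^+ 2)%R))%E//.
  exact: integrableD.
apply: (@le_trans _ _ (\int[mu]_s (h s)%:E)%E).
  apply: ge0_le_integral => //.
  - by move=> s _; rewrite lee_fin lyapunov_ge0.
  - apply/measurable_EFinP/measurable_lyapunov/measurable_snag_step => //.
  - exact: measurable_int ih.
  - by move=> s _; rewrite lee_fin.
rewrite -[leLHS]fineK; last exact: integrable_fin_num ih.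
rewrite lee_fin -/(Rintegral _ _ _) RintegralD// RintegralD// RintegralZl//; last first.
  exact: integrable_sqr_gradient.
have muT : fine (mu setT) = 1 by rewrite probability_setT.
rewrite Rintegral_cst// [fine _]muT mulr1 Rintegral_dot//.
have D0 : 0 <= D by rewrite mulr_ge0 ?sqr_ge0.
have := ler_wpM2l D0 (Rintegral_sqr_gradient x).
set E := (X in D * X <= _) => hE; rewrite -/E.
have F1 := objective_ge_N1 x.
(* With [p] replaced by its mean [G x], the cross terms in [dot m (G x)] cancel and the remaining
   [- g ^+ 2 * dot (G x) (G x)] is dropped. *)
apply: (@le_trans _ _ ((1 + D * C) * (1 + F x) + c * a ^+ 2 * dot m m)).
  rewrite /A /B -/G !dotE (dotC (G x) m).
  have := mulr_ge0 (sqr_ge0 g) (dot_ge0 (G x)).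
  by move=> hG; nra.
rewrite /step_factor /lyapunov /= -/F -/c.
set M := Num.max 1 (a ^+ 2).
have M1 : 1 <= M by rewrite le_max lexx.
have Ma : a ^+ 2 <= M by rewrite le_max lexx orbT.
have g2 := sqr_ge0 g.
have Lg : 0 <= L * g ^+ 2 by exact: mulr_ge0.
have Ccg : 0 <= C * c * g ^+ 2 by rewrite !mulr_ge0// ltW.
set K := 1 + (4 * L + C * c) * g ^+ 2.
have KE : K = 1 + 4 * (L * g ^+ 2) + C * c * g ^+ 2 by rewrite /K; ring.
have K0 : 0 <= K by rewrite KE; lra.
have M0 : 0 <= M by exact: le_trans M1.
rewrite [leRHS]mulrDr; apply: lerD.
  apply: ler_wpM2r => //; apply: (@le_trans _ _ K).
    by rewrite KE /D; lra.
  by rewrite ler_peMl.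
rewrite mulrA [leRHS]mulrAC; apply: ler_wpM2r; first exact: dot_ge0.
rewrite mulrC -[leRHS]mulrA; apply: ler_pM => //; first exact: sqr_ge0.
have cE : c = 1/2 + 2 * (L * g ^+ 2) by rewrite /c; ring.
by rewrite KE; lra.
Qed.
End lyapunov.

(** * Step sizes *)

Section step_sizes.
Context (R : realType) (gamma : nat -> R).
Hypothesis gamma_gt0 : forall n, (1 <= n)%N -> 0 < gamma n.

Lemma sum_sqr_bounded : (\sum_(1 <= k <oo) (gamma k ^+ 2)%R%:E < +oo)%E ->
  exists2 S : R, 0 <= S & forall n, \sum_(k < n) gamma k.+1 ^+ 2 <= S.
Proof.
move=> fin.
have ge0 k : xpredT k -> (0 <= (gamma k ^+ 2)%:E)%E by rewrite lee_fin sqr_ge0.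
have S0 : (0 <= \sum_(1 <= k <oo) (gamma k ^+ 2)%R%:E)%E.
  by apply: nneseries_ge0 => k _ _; exact: ge0.
exists (fine (\sum_(1 <= k <oo) (gamma k ^+ 2)%R%:E)%E); first exact: fine_ge0.
move=> n; rewrite -lee_fin fineK ?ge0_fin_numE//.
apply: le_trans (nneseries_lim_ge n.+1 _); last by move=> k _ _; exact: ge0.
by rewrite sumEFin lee_fin big_add1 big_mkord.
Qed.

Lemma tau_unbounded : (\sum_(1 <= k <oo) (gamma k)%:E = +oo)%E ->
  forall A : R, exists N, forall n, (N <= n)%N -> A <= tau gamma n.
Proof.
move=> sumy A.
have ndtau m n : (m <= n)%N -> tau gamma m <= tau gamma n.
  move=> mn; rewrite /tau [leRHS](big_cat_nat (n := m.+1))//=.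
  rewrite lerDl big_nat; apply: sumr_ge0 => k /andP[mk _].
  by apply/ltW/gamma_gt0; exact: leq_trans mk.
suff [N AN] : exists N, A <= tau gamma N.
  by exists N => n /ndtau; exact: le_trans.
apply: contrapT => h.
suff : (\sum_(1 <= k <oo) (gamma k)%:E <= A%:E)%E by rewrite sumy leye_eq.
apply: lime_le.
  by apply: is_cvg_nneseries => k k1 _; rewrite lee_fin ltW// gamma_gt0.
apply: nearW => n; rewrite sumEFin lee_fin.
(* Off by one: the series sums over indices below [n], so its partial sum is [tau gamma n.-1]; both
   sums are empty for [n = 0]. *)
have : tau gamma n.-1 <= A.
  by rewrite leNgt; apply/negP => /ltW An; apply: h; exists n.-1.
case: n => [|n]//=; apply: le_trans; rewrite big_geq// sumr_ge0//.
Qed.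

(** Both products are compared with the one over [n + N] factors: those after the first [N] are 1,
    and dropping factors that are at least 1 cannot increase a product. *)
Lemma prod_bounded_stationary (M : nat -> R) N :
  (forall k, 1 <= M k) -> (forall k, (N <= k)%N -> M k = 1) ->
  forall n, \prod_(k < n) M k <= \prod_(k < N) M k.
Proof.
move=> M1 MN n.
have M0 k : 0 <= M k by exact: le_trans (M1 k).
have -> : \prod_(k < N) M k = \prod_(k < n + N) M k.
  elim: n => // n ->; rewrite addSn big_ord_recr/= MN ?mulr1//.
  exact: leq_addl.
elim: N {MN} => [|N IH]; first by rewrite addn0.
rewrite addnS big_ord_recr/=; apply: le_trans IH _.
by rewrite ler_peMr// prodr_ge0.
Qed.

(** The two parts of [step_factor] are bounded separately. The maxima differ from 1 for finitely
    many indices at most; the other parts are at most [expR (K * gamma k.+1 ^+ 2)], whose product is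
    at most [expR (K * S)]. *)
Lemma prod_step_factor_bounded (C L alpha : R) : 0 < C -> 0 <= L -> 0 < alpha ->
  (\sum_(1 <= k <oo) (gamma k)%:E = +oo)%E ->
  (\sum_(1 <= k <oo) (gamma k ^+ 2)%R%:E < +oo)%E ->
  exists B : R, forall n,
    \prod_(k < n) step_factor C L (1 - alpha * gamma k.+1 / tau gamma k)
      (gamma k.+1) <= B.
Proof.
move=> C0 L0 a0 sum1 /sum_sqr_bounded[S S0 hS].
pose a k := 1 - alpha * gamma k.+1 / tau gamma k.
pose K := 4 * L + C * (1 / 2 + 2 * L * S).
have coef0 s : 0 <= s -> 0 <= 4 * L + C * (1 / 2 + 2 * L * s).
  move=> s0; apply: addr_ge0; first exact: mulr_ge0.
  by rewrite pmulr_rge0//; apply: addr_ge0 => //; rewrite !mulr_ge0.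
have K0 : 0 <= K by exact: coef0.
have fac0 g : 0 <= 1 + (4 * L + C * (1 / 2 + 2 * L * g ^+ 2)) * g ^+ 2.
  by rewrite addr_ge0// mulr_ge0 ?sqr_ge0//; apply: coef0; exact: sqr_ge0.
have gS k : gamma k.+1 ^+ 2 <= S.
  apply: le_trans (hS k.+1); rewrite big_ord_recr/= lerDr sumr_ge0// => i _.
  exact: sqr_ge0.
have gS1 k : gamma k.+1 <= 1 + S.
  (* From [2 * g <= 1 + g ^+ 2 <= 1 + S], with [g] the step size. *)
  have := gS k; have := sqr_ge0 (gamma k.+1 - 1); rewrite sqrrB1 => h1 h2.
  by have := gamma_gt0 (ltn0Sn k); lra.
(* Once [tau] reaches [alpha * (1 + S)], the quotient subtracted in [a k] lies in [[0, 1]]. *)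
have [N hN] := tau_unbounded sum1 (alpha * (1 + S)).
have aN k : (N <= k)%N -> Num.max 1 (a k ^+ 2) = 1.
  move=> /hN tk; apply/max_idPl.
  have t0 : 0 < tau gamma k.
    by apply: lt_le_trans tk; rewrite mulr_gt0// ltr_pwDl.
  have q1 : alpha * gamma k.+1 / tau gamma k <= 1.
    by rewrite ler_pdivrMr// mul1r; apply: le_trans tk; rewrite ler_wpM2l// ltW.
  have q0 : 0 <= alpha * gamma k.+1 / tau gamma k.
    by rewrite divr_ge0 ?mulr_ge0// ltW// gamma_gt0.
  by rewrite expr_le1// /a; lra.
pose M k := Num.max 1 (a k ^+ 2).
exists (\prod_(k < N) M k * expR (K * S)) => n.
rewrite /step_factor big_split/=; apply: ler_pM.
- by apply: prodr_ge0 => k _; rewrite le_max ler01.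
- by apply: prodr_ge0 => k _; exact: fac0.
- by apply: (@prod_bounded_stationary M) => // k; rewrite /M le_max lexx.
apply: (@le_trans _ _ (expR (K * \sum_(k < n) gamma k.+1 ^+ 2))); last first.
  by rewrite ler_expR ler_wpM2l.
rewrite mulr_sumr expR_sum; apply: ler_prod => k _; rewrite fac0/=.
apply: le_trans (expR_ge1Dx _); rewrite lerD2l ler_wpM2r ?sqr_ge0// /K.
by rewrite lerD2l ler_pM2l// lerD2l ler_wpM2l ?mulr_ge0.
Qed.

End step_sizes.

(** * The past of the samples *)

Section past.
Context dO dXi (Omega : measurableType dO) (Xi : measurableType dXi)
  (R : realType) (P : probability Omega R) (mu : probability Xi R).
Variable xi : nat -> {RV P >-> Xi}.

(* A pi-system generating the sigma-algebra of [xi 1, ..., xi n]. *)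
Definition past_events (n : nat) : set (set Omega) :=
  [set E | exists2 B : nat -> set Xi, (forall k, measurable (B k)) &
    E = \bigcap_(k in [set k | (1 <= k <= n)%N]) xi k @^-1` B k].

Lemma past_events_measurable n : past_events n `<=` measurable.
Proof.
move=> _ [B mB ->]; apply: bigcap_measurableType => k _.
exact: measurable_funPTI.
Qed.

Lemma past_events_setI n : setI_closed (past_events n).
Proof.
move=> _ _ [B mB ->] [B' mB' ->]; exists (fun k => B k `&` B' k).
  by move=> k; exact: measurableI.
by rewrite -bigcapI; apply: eq_bigcapr => k _; rewrite preimage_setI.
Qed.

Lemma past_events_setT n : past_events n setT.
Proof.
exists (fun=> setT) => //; apply/seteqP; split=> // w _ k _ //.
Qed.

Lemma measurable_past n k : (1 <= k <= n)%N ->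
  measurable_fun [set: g_sigma_algebraType (past_events n)] (xi k).
Proof.
move=> kn _ D mD; rewrite setTI; apply: sub_sigma_algebra.
exists (fun j => if j == k then D else setT).
  by move=> j; case: ifP.
apply/seteqP; split=> w /= h; first by move=> j _ /=; case: eqP => // ->.
by have := h k kn; rewrite /= eqxx.
Qed.

(** The intersection is an event on the samples [1] to [n.+1]. Independence over these indices and
    over [1] to [n] gives two products that differ by the factor of the new sample, whose law is
    [mu]. *)
Lemma past_events_independent n A B :
  iid_with_law [set n | (1 <= n)%N] xi mu -> past_events n A -> measurable B ->
  P (A `&` xi n.+1 @^-1` B) = (P A * mu B)%E.
Proof.
move=> [law ind] [D mD ->] mB.
pose J := [fset k in iota 1 n]%fset.
have JE : [set` J] = [set k | (1 <= k <= n)%N].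
  by apply/seteqP; split=> k /=; rewrite !inE mem_iota add1n ltnS.
have nJ : n.+1 \notin J by rewrite !inE mem_iota add1n ltnn andbF.
pose D' k := if k == n.+1 then B else D k.
have D'E k : k \in J -> D' k = D k.
  by move=> kJ; rewrite /D'; case: eqP => // kn; move: nJ; rewrite -kn kJ.
have mD' k : measurable (D' k) by rewrite /D'; case: ifP.
have J1 : [set` (n.+1 |` J)%fset] `<=` [set n | (1 <= n)%N].
  move=> k /=; rewrite in_fset1U => /orP[/eqP -> //|].
  by move=> kJ; have : [set` J] k by []; rewrite JE /= => /andP[].
have JD : [set` J] `<=` [set n | (1 <= n)%N].
  by rewrite JE => k /= /andP[].
rewrite -(law n.+1)// -JE.
have := ind (n.+1 |` J)%fset D' J1 (fun k _ => mD' k).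
rewrite big_fsetU1//= => indE.
transitivity (P (\bigcap_(i in [set` (n.+1 |` J)%fset]) xi i @^-1` D' i)).
  congr (P _); apply/seteqP; split=> w /=.
    move=> [h hB] k /=; rewrite in_fset1U => /orP[/eqP ->|kJ].
      by rewrite /D' eqxx.
    by rewrite D'E//; exact: h.
  move=> h; split.
    by move=> k /= kJ; rewrite -D'E//; apply: h; rewrite /= in_fset1U kJ orbT.
  by have := h n.+1; rewrite /D' eqxx; apply; rewrite /= in_fset1U eqxx.
rewrite indE muleC {2}/D' eqxx; congr (_ * _)%E.
rewrite (ind J D JD (fun k _ => mD k)).
by rewrite big_seq [RHS]big_seq; apply: eq_bigr => k kJ; rewrite D'E.
Qed.

End past.

(** * From bounded energy to bounded iterates *)

Lemma normr_le_enorm (R : realType) (d : nat) (x : 'rV[R]_d) : `|x| <= enorm x.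
Proof.
rewrite [leLHS]/Num.Def.normr/= mx_normrE (bigmax_le _ (enorm_ge0 _))//= => -[i j] _.
by rewrite ord1; exact: coord_le_enorm.
Qed.

Lemma bounded_of_lyapunov (R : realType) (d : nat) (dXi : measure_display)
    (Xi : measurableType dXi) (mu : probability Xi R) (f : 'rV[R]_d -> Xi -> R)
    (y : nat -> 'rV[R]_d * 'rV[R]_d) (B : R) :
  (forall A : R, exists B : R, forall x : 'rV[R]_d,
     B <= enorm x -> A <= objective mu f x) ->
  (forall x, 0 <= 1 + objective mu f x) ->
  (forall n, lyapunov mu f (y n) <= B) -> bounded_fun y.
Proof.
move=> coer F1 yB.
have [D hD] := coer (B + 1).
(* For the momentum, [2 * |m| <= 1 + |m|^2 <= 1 + 2 * B]. The position stays within [D], beyond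
   which the objective would be at least [B + 1], whereas the energy bound keeps it at most
   [B - 1]. *)
exists (Num.max (1 + 2 * B) D); split; first exact: num_real.
move=> M; rewrite gt_max => /andP[M1 M2] n _.
have := yB n; rewrite /lyapunov => h.
have m0 := dot_ge0 (y n).1; have Fn := F1 (y n).2.
rewrite /= prod_normE ge_max; apply/andP; split.
  apply: le_trans (normr_le_enorm _) (ltW (le_lt_trans _ M1)).
  have := sqr_ge0 (enorm (y n).1 - 1); rewrite sqrrB1 enorm_sqr.
  by have := enorm_ge0 (y n).1; lra.
apply: le_trans (normr_le_enorm _) (ltW (lt_trans _ M2)).
by rewrite ltNge; apply/negP => /hD; lra.
Qed.

Lemma measurable_fun_sub_sigma_algebra d1 d2 (T : measurableType d1)
    (T' : measurableType d2) (C : set (set T)) (g : T -> T') :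
  C `<=` measurable -> measurable_fun [set: g_sigma_algebraType C] g ->
  measurable_fun [set: T] g.
Proof.
move=> Cm mg _ B mB.
have Cs : <<s C >> `<=` measurable.
  by apply: smallest_sub => //; exact: sigma_algebra_measurable.
apply: Cs; exact: mg.
Qed.

Theorem theorem3p4 (R : realType) (d : nat) (d_ge1 : (1 <= d)%N)
  (dXi : measure_display) (Xi : measurableType dXi) (mu : probability Xi R)
  (f : 'rV[R]_d -> Xi -> R)
  (f_meas : measurable_fun [set: borel_rV R d * Xi] (fun p => f p.1 p.2))
  (f_int : forall x, mu.-integrable [set: Xi] (EFin \o f x))
  (f_diff : forall s x, differentiable (fun z => f z s) x)
  (df_int : forall x, integrable_rV mu (gradient_in f x))
  (df_lip : locally_lipschitz_gradient mu f)
  (gamma : nat -> R) (gamma_gt0 : forall n, (1 <= n)%N -> 0 < gamma n)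
  (dO : measure_display) (Omega : measurableType dO) (P : probability Omega R)
  (xi : nat -> {RV P >-> Xi})
  (xi_iid : iid_with_law [set n | (1 <= n)%N] xi mu)
  (alpha : R) (alpha_gt0 : 0 < alpha) (x0 : 'rV[R]_d)
  (F_coercive : forall A : R, exists B : R, forall x : 'rV[R]_d,
     B <= enorm x -> A <= objective mu f x)
  (gamma_ratio : gamma n.+1 / gamma n @[n --> \oo] --> (1 : R))
  (gamma_sum : (\sum_(1 <= k <oo) (gamma k)%:E = +oo)%E)
  (gamma_sum2 : (\sum_(1 <= k <oo) (gamma k ^+ 2)%R%:E < +oo)%E)
  (dF_lip : exists L : R, forall x y : 'rV[R]_d,
     enorm (gradient (objective mu f) x - gradient (objective mu f) y)
       <= L * enorm (x - y))
  (df_growth : exists2 C : R, 0 < C & forall x : 'rV[R]_d,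
     ('E_mu[fun s => (enorm (gradient_in f x s) ^+ 2)%R]
       <= (C * (1 + objective mu f x))%R%:E)%E) :
  {ae P, forall w,
     bounded_fun (fun n => snag f gamma alpha x0 (fun k => xi k w) n)}.

Proof.
have [L0 hL0] := dF_lip; have [C C0 hC] := df_growth.
pose L := Num.max 0 L0.
have L_ge0 : 0 <= L by rewrite le_max lexx.
have hL x y : enorm (gradient (objective mu f) x - gradient (objective mu f) y)
    <= L * enorm (x - y).
  by apply: le_trans (hL0 x y) _; rewrite ler_wpM2r ?enorm_ge0// le_max lexx orbT.
pose a k := 1 - alpha * gamma k.+1 / tau gamma k.
pose r k := step_factor C L (a k) (gamma k.+1).
pose Y n (w : Omega) := snag f gamma alpha x0 (fun k => xi k w) n.
pose W := lyapunov mu f.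
pose Q n := \prod_(k < n) r k.
have [B hB] : exists B, forall n, Q n <= B by exact: prod_step_factor_bounded.
have g0 k : 0 <= gamma k.+1 by exact/ltW/gamma_gt0.
have r0 k : 0 < r k.
  apply: mulr_gt0; first by rewrite lt_max ltr01.
  apply: ltr_pwDl => //; apply: mulr_ge0; last exact: sqr_ge0.
  apply: addr_ge0; first exact: mulr_ge0.
  rewrite pmulr_rge0//; apply: addr_ge0 => //.
  by apply: mulr_ge0; [exact: mulr_ge0|exact: sqr_ge0].
have Q0 n : 0 < Q n by exact: prodr_gt0.
have QS n : Q n.+1 = Q n * r n by rewrite /Q big_ord_recr.
have W0 y : 0 <= W y by exact: (lyapunov_ge0 C0 hC).
pose V n w := W (Y n w) / Q n.
have V0 n w : 0 <= V n w by rewrite divr_ge0// ltW.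
have mVpast n k : (k <= n)%N ->
    measurable_fun [set: g_sigma_algebraType (past_events xi n)] (V k).
  move=> kn; apply: measurable_funM => //.
  apply: (measurable_lyapunov mu f_meas).
  apply: measurable_snag => // j /andP[j1 jk].
  by apply: measurable_past; rewrite j1 (leq_trans jk).
have mV n : measurable_fun setT (V n).
  apply: measurable_funM => //.
  apply: (measurable_lyapunov mu f_meas).
  by apply: measurable_snag.
have super lam n : (\int[P]_(w in below V lam n.+1) (V n.+1 w)%:E
    <= \int[P]_(w in below V lam n.+1) (V n w)%:E)%E.
  set A := below V lam n.+1.
  have mA : measurable (A : set (g_sigma_algebraType (past_events xi n))).
    by apply: measurable_below => k; rewrite ltnS; exact: mVpast.
  have mA' : measurable A by apply: measurable_below => k _; exact: mV.
  (* The integrand of [V n.+1] on [A] with the sample [n.+1] set free; all the rest is determined by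
     the past, as freezing requires. *)
  pose h (p : g_sigma_algebraType (past_events xi n) * Xi) :=
    ((\1_A p.1 / Q n.+1)%:E *
     (W (snag_step f (a n) (gamma n.+1) (Y n p.1) p.2))%:E)%E.
  have c0 w : 0 <= \1_A w / Q n.+1.
    by apply: divr_ge0; [rewrite indicE|exact: ltW].
  have mh : measurable_fun setT h.
    apply/measurable_EFinP; apply: measurable_funM.
      apply: measurable_funM => //.
      apply: measurableT_comp measurable_fst.
      exact: measurable_indic.
    apply: (measurable_lyapunov mu f_meas).
    apply: measurable_snag_step => //.
    apply: measurable_snag => // k kn.
    apply: measurableT_comp measurable_fst.
    exact: measurable_past.
  have h0 p : (0 <= h p)%E by rewrite mule_ge0// lee_fin.
  have frz := ge0_integral_freezing (@measurable_funPT _ _ _ _ (xi n.+1))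
    (@past_events_measurable _ _ _ _ _ _ xi n) (@past_events_setI _ _ _ _ _ _ xi n)
    (@past_events_setT _ _ _ _ _ _ xi n)
    (fun A B => @past_events_independent _ _ _ _ _ _ mu xi n A B xi_iid) mh h0.
  rewrite [leLHS](_ : _ = \int[P]_w h (w, xi n.+1 w))%E; last first.
    rewrite integral_mkcond; apply: eq_integral => w _.
    rewrite restrict_EFin /h /= -EFinM; congr EFin.
    rewrite patchE indicE; case: ifPn => _; last by rewrite !mul0r.
    by rewrite /V /Y snagS mul1r mulrC.
  rewrite frz [leRHS]integral_mkcond.
  apply: ge0_le_integral => //.
  - by move=> w _; apply: integral_ge0.
  - apply: (measurable_fun_sub_sigma_algebra
      (@past_events_measurable _ _ _ _ _ _ xi n)).
    exact: (measurable_fun_fubini_tonelli_F h mh h0).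
  - apply/(measurable_restrictT _ mA').
    by apply: measurable_funTS; apply/measurable_EFinP.
  (* For a fixed past, the one-step estimate applies to the fresh sample, and its factor [r n]
     cancels against [Q n.+1 = Q n * r n]. *)
  move=> w _; rewrite /= patchE /h /=.
  rewrite ge0_integralZl_EFin//; last 2 first.
  - by move=> s _; rewrite lee_fin.
  - apply/measurable_EFinP/(measurable_lyapunov mu f_meas).
    exact: measurable_snag_step.
  have step := lyapunov_step f_meas f_int f_diff df_int df_lip C0 L_ge0 hL hC
    (a n) (Y n w) (g0 n).
  apply: (@le_trans _ _ ((\1_A w / Q n.+1)%:E * (r n * W (Y n w))%:E)%E).
    by apply: lee_wpmul2l; rewrite ?lee_fin.
  rewrite -EFinM indicE; case: ifPn => _; last by rewrite !mul0r.
  rewrite lee_fin QS /V mul1r invfM [leRHS]mulrC -mulrA.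
  by rewrite (mulrA _ (r n)) mulVf ?mul1r// gt_eqF.
have aeV : {ae P, forall w, exists D : R, forall n, V n w <= D}.
  apply: (@ae_bounded_supermartingale _ _ _ P V mV V0 (W (0, x0) / Q 0)) super.
  rewrite (eq_integral (cst (W (0, x0) / Q 0)%:E)) => [|w _]; last by [].
  rewrite integral_cst// [X in (_ * X)%E](_ : _ = 1%E) ?mule1//.
  exact: probability_setT.
apply: filterS aeV => w [D hD].
have D0 : 0 <= D by apply: le_trans (hD 0%N).
apply: (@bounded_of_lyapunov _ _ _ _ mu f _ (D * B)) => //.
  by move=> x; exact: (objective_ge_N1 C0 hC).
move=> n; apply: (@le_trans _ _ (D * Q n)); last by rewrite ler_wpM2l.
by rewrite -ler_pdivrMr//; exact: hD.
Qed.
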